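(* $\vec\chi(Forb_{ind}(\overleftrightarrow{K_2}, K_3, P^+(3)))=2$; that is, every oriented graph whose underlying graph is triangle-free and which has no induced directed path with $3$ arcs has dichromatic number at most $2$, and $2$ is attained.
   Context: Digraphs have no loops and no parallel arcs, but both $xy$ and $yx$ may be arcs. The dichromatic number $\vec\chi(D)$ is the minimum number of colors in a vertex coloring in which no color class induces a directed cycle; $\vec\chi(\mathcal C)=\sup_{D\in\mathcal C}\vec\chi(D)$. For a set $\mathcal F$ of digraphs and undirected graphs, $Forb_{ind}(\mathcal F)$ is the class of digraphs containing as an induced subdigraph neither a digraph in $\mathcal F$ nor any orientation of an undirected graph in $\mathcal F$. $\overleftrightarrow{K_2}$ is the digon; $K_3$ is the undirected triangle (so all its orientations are forbidden); $P^+(3)$ is the directed path with $3$ arcs. *)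

(* Defs.v *)
From mathcomp Require Import all_boot.
From mathcomp Require Import boolp.

Set Implicit Arguments.
Unset Strict Implicit.
Unset Printing Implicit Defensive.

(* Finite and loopless; both [arc x y] and [arc y x] may hold. *)
Record digraph := Digraph {
  vertex :> finType;
  arc : rel vertex;
  arc_irr : irreflexive arc }.

Record ugraph := UGraph {
  uvertex :> finType;
  adj : rel uvertex;
  adj_sym : symmetric adj;
  adj_irr : irreflexive adj }.

(* By irreflexivity such a [c] has at least two vertices; a digon counts as a
   directed cycle of length 2. *)
Definition induces_dicycle (D : digraph) (S : {pred D}) : Prop :=
  exists c : seq D, [/\ c != [::], {subset c <= S} & ucycle (@arc D) c].

Definition dicoloring (D : digraph) (k : nat) (f : D -> 'I_k) : Prop :=
  forall i : 'I_k, ~ induces_dicycle [pred x : D | f x == i].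

Definition dicolorable (D : digraph) (k : nat) : Prop :=
  exists f : D -> 'I_k, dicoloring f.

Lemma dicolorable_card (D : digraph) : dicolorable D #|D|.
Proof.
exists enum_rank => i [[|x [|y c]]] [] // _ sub /andP[].
  by rewrite /= arc_irr.
have /eqP fx := sub x (mem_head _ _).
have /sub/eqP : y \in [:: x, y & c] by rewrite !inE eqxx orbT.
rewrite -fx => /enum_rank_inj ->.
by rewrite /= mem_head.
Qed.

Lemma dicolorable_ex (D : digraph) : exists k, `[< dicolorable D k >].
Proof. by exists #|D|; apply/asboolP/dicolorable_card. Qed.

Definition dichromatic_number (D : digraph) : nat := ex_minn (dicolorable_ex D).

(* The supremum, over the class [C], of the dichromatic number is the finite
   value [k]. *)
Definition class_dichromatic_number (C : digraph -> Prop) (k : nat) : Prop :=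
  (forall D, C D -> dichromatic_number D <= k) /\
  (forall m, (forall D, C D -> dichromatic_number D <= m) -> k <= m).

Definition induced_in (H D : digraph) : Prop :=
  exists f : H -> D, injective f /\ forall x y, arc (f x) (f y) = arc x y.

Definition orientation_of (G : ugraph) (e : rel G) : Prop :=
  forall x y, adj x y = (e x y || e y x) /\ ~~ (e x y && e y x).

Lemma orientation_irr (G : ugraph) (e : rel G) :
  orientation_of e -> irreflexive e.
Proof. by move=> oe x; case: (oe x x) => _; rewrite andbb => /negbTE. Qed.

Definition oriented (G : ugraph) (e : rel G) (oe : orientation_of e) : digraph :=
  Digraph (orientation_irr oe).

Inductive pattern := Directed of digraph | Undirected of ugraph.

Definition avoids (D : digraph) (X : pattern) : Prop :=
  match X with
  | Directed H => ~ induced_in H D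
  | Undirected G =>
      forall (e : rel G) (oe : orientation_of e), ~ induced_in (oriented oe) D
  end.

Definition Forb_ind (F : pattern -> Prop) (D : digraph) : Prop :=
  forall X, F X -> avoids D X.

Definition neq_rel (T : eqType) : rel T := fun x y => x != y.

Lemma neq_rel_irr (T : eqType) : irreflexive (@neq_rel T).
Proof. by move=> x; rewrite /neq_rel eqxx. Qed.

Lemma neq_rel_sym (T : eqType) : symmetric (@neq_rel T).
Proof. by move=> x y; rewrite /neq_rel eq_sym. Qed.

Definition complete_graph (n : nat) : ugraph :=
  UGraph (@neq_rel_sym 'I_n) (@neq_rel_irr 'I_n).

Definition complete_digraph (n : nat) : digraph :=
  Digraph (@neq_rel_irr 'I_n).

Definition digon : digraph := complete_digraph 2.

Definition succ_rel (n : nat) : rel 'I_n := fun i j => j == i.+1 :> nat.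

Lemma succ_rel_irr (n : nat) : irreflexive (@succ_rel n).
Proof. by move=> i; rewrite /succ_rel ltn_eqF. Qed.

(* [k] arcs, hence [k.+1] vertices. *)
Definition directed_path (k : nat) : digraph := Digraph (@succ_rel_irr k.+1).

(* Main.v *)
From mathcomp Require Import all_boot.
From mathcomp Require Import boolp.
Require Import Defs.

Set Implicit Arguments.
Unset Strict Implicit.
Unset Printing Implicit Defensive.

(** In the class considered, the ends of a directed walk with 3 arcs are
    adjacent. By induction this holds for every walk of odd length: given
    x0 -> x1 -> x2 ~> u -> v -> y with n + 2 arcs, both x2, y and x0, u are
    adjacent by induction; a forward arc x2 -> y or x0 -> u gives a walk with
    3 arcs from x0 to y, and otherwise y -> x2 ~> u -> x0 has n arcs.
    Hence there is no closed walk of odd length, so every strong component is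
    bipartite, and 2-coloring the components independently leaves no
    monochromatic directed cycle. The directed 4-cycle needs two colors. *)

Section Walks.

Variable D : digraph.
Implicit Types (x y z : D) (m n : nat).

(** Vertices may repeat, so walks concatenate freely; the length is an index because the argument is
    about its parity. *)
Fixpoint walk n x y : Prop :=
  if n is n'.+1 then exists2 z, arc x z & walk n' z y else x = y.

Definition adjacent x y := arc x y || arc y x.

Lemma adjacentC x y : adjacent x y = adjacent y x.
Proof. exact: orbC. Qed.

Lemma adjacentxx x : adjacent x x = false.
Proof. by rewrite /adjacent arc_irr. Qed.

Lemma walk_cat m n x y z : walk m x y -> walk n y z -> walk (m + n) x z.
Proof.
elim: m x => [x -> //|m IHm x [w xw wy] yz].
by exists w => //; apply: IHm yz.
Qed.

Lemma walk_split m n x z :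
  walk (m + n) x z -> exists2 y, walk m x y & walk n y z.
Proof.
elim: m x => [x xz|m IHm x [w xw /IHm[y wy yz]]]; first by exists x.
by exists y => //; exists w.
Qed.

Lemma arc_walk x y : arc x y -> walk 1 x y.
Proof. by move=> xy; exists y. Qed.

Lemma walk_connect x y : connect (@arc D) x y -> exists n, walk n x y.
Proof.
case/connectP=> p; elim: p x => [|z p IHp] x /=; first by exists 0.
case/andP=> xz zp /(IHp _ zp)[n zy]; by exists n.+1, z.
Qed.

End Walks.

Section Bipartite.

Variable D : digraph.

Hypothesis walk3_adjacent : forall x y : D, walk 3 x y -> adjacent x y.

Lemma odd_walk_adjacent n (x y : D) : odd n -> walk n x y -> adjacent x y.
Proof.
(* Lengths 0, 2 and 4 fall to parity, and 1 and 3 are the base cases. A remaining walk has [n.+5]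
   arcs, two before [x2] and two after [u]. *)
elim/ltn_ind: n x y => -[//|[|[//|[|[//|n]]]]] IHn x0 y.
- by move=> _ [z xz /= <-]; rewrite /adjacent xz.
- by move=> _; apply: walk3_adjacent.
rewrite /= !negbK => odd_n [x1 x01 [x2 x12 x2y]].
have [u x2u uy] : exists2 u, walk n.+1 x2 u & walk 2 u y.
  by apply: walk_split; rewrite addn2.
have x02 : walk 2 x0 x2 by exists x1 => //; apply: arc_walk.
have : adjacent x2 y.
  by apply: (IHn n.+3) x2y; rewrite //= !negbK.
case/orP=> [arc_x2y|yx2].
  by apply/walk3_adjacent/(walk_cat x02)/arc_walk.
have : adjacent x0 u.
  by apply: (IHn (2 + n.+1)) (walk_cat x02 x2u); rewrite //= !negbK.
case/orP=> [x0u|ux0].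
  exact/walk3_adjacent/(walk_cat (arc_walk x0u)).
rewrite adjacentC; apply: (IHn (1 + (n.+1 + 1))).
- by rewrite addn1.
- by rewrite addn1 /= !negbK.
exact: walk_cat (arc_walk yx2) (walk_cat x2u (arc_walk ux0)).
Qed.

(** An odd closed walk would make [x] adjacent to itself. *)
Lemma closed_walk_even n (x : D) : walk n x x -> ~~ odd n.
Proof.
move=> xx; apply/negP=> /odd_walk_adjacent/(_ xx).
by rewrite adjacentxx.
Qed.

Definition strongly_connected : rel D :=
  fun x y => connect (@arc D) x y && connect (@arc D) y x.

(** A canonical representative: [pick] depends only on the set of candidates, which is the same for
    all vertices of a strong component. *)
Definition component_root (x : D) : D := odflt x [pick y | strongly_connected x y].

Lemma component_rootP x : strongly_connected x (component_root x).
Proof.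
rewrite /component_root; case: pickP => //= /(_ x).
by rewrite /strongly_connected connect0.
Qed.

Lemma component_root_eq x y :
  strongly_connected x y -> component_root x = component_root y.
Proof.
case/andP=> xy yx; rewrite /component_root.
have /eq_pick -> : strongly_connected x =1 strongly_connected y.
  move=> z; apply/andP/andP=> -[to_z from_z]; split.
  - exact: connect_trans yx to_z.
  - exact: connect_trans from_z xy.
  - exact: connect_trans xy to_z.
  - exact: connect_trans from_z yx.
(* The defaults [x] and [y] differ, but [pick] succeeds because [y] lies in its own component. *)
by case: pickP => // /(_ y); rewrite /strongly_connected connect0.
Qed.

(** When closed walks are even, all walks from the root to [x] have the same parity, as a common
    walk back closes them up. *)
Definition parity_coloring (x : D) : 'I_2 :=
  inord `[< exists2 n, ~~ odd n & walk n (component_root x) x >].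

Lemma parity_coloring_arc x y :
  arc x y -> connect (@arc D) y x -> parity_coloring x != parity_coloring y.
Proof.
move=> xy yx; apply/eqP=> /(congr1 val).
have scxy : strongly_connected x y by rewrite /strongly_connected connect1.
rewrite /= !inordK ?ltnS ?leq_b1 // -(component_root_eq scxy).
case/andP: (component_rootP x) => xr rx.
have [k yrk] := walk_connect (connect_trans yx xr).
have [l rxl] := walk_connect rx.
(* Equal colors leave two cases. If both vertices have even walks from the root, the walk of length
   [k] closes them into two closed walks of different parity. If neither has, the walk of length [l]
   to [x] is odd and extends to an even one to [y]. *)
case: asboolP => [[n even_n rxn]|odd_x]; case: asboolP => [[m even_m rym]|odd_y] // _.
  have := closed_walk_even (walk_cat rym yrk).
  have := closed_walk_even (walk_cat (walk_cat rxn (arc_walk xy)) yrk).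
  by rewrite !oddD (negbTE even_n) (negbTE even_m) /= => /negbTE ->.
have [odd_l|even_l] := boolP (odd l); last by apply: odd_x; exists l.
apply: odd_y; exists (l + 1); first by rewrite oddD odd_l.
exact: walk_cat rxl (arc_walk xy).
Qed.

(** The first arc of a directed cycle already has two colors, since the rest of the cycle leads back
    to its tail. *)
Lemma parity_coloringP : dicoloring parity_coloring.
Proof.
move=> i [[|x p]] [] // _ sub /andP[+ _].
have /eqP fx := sub x (mem_head _ _).
case: p sub => [|y p] sub; first by rewrite /= arc_irr.
have /sub/eqP fy : y \in [:: x, y & p] by rewrite !inE eqxx orbT.
rewrite /= => /andP[xy yp].
have yx : connect (@arc D) y x.
  by apply/connectP; exists (rcons p x); rewrite ?last_rcons.
by have := parity_coloring_arc xy yx; rewrite fx fy eqxx.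
Qed.

End Bipartite.

Section ForbiddenPatterns.

Variable D : digraph.

Lemma avoids_digon_asym (x y : D) :
  avoids D (Directed digon) -> arc x y -> ~~ arc y x.
Proof.
move=> av xy; apply/negP=> yx; apply: av.
exists (tnth [tuple x; y]); split.
  have neq_xy : x != y by apply/eqP=> exy; rewrite exy arc_irr in xy.
  by apply/tuple_uniqP; rewrite /= inE neq_xy.
by move=> [[|[|//]] ?] [[|[|//]] ?]; rewrite !(tnth_nth x) /= ?arc_irr ?xy ?yx.
Qed.

Lemma avoids_triangle_free (x y z : D) :
  avoids D (Directed digon) -> avoids D (Undirected (complete_graph 3)) ->
  adjacent x y -> adjacent y z -> ~~ adjacent x z.
Proof.
move=> avd avt xy yz; apply/negP=> xz.
pose f := tnth [tuple x; y; z].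
have adj_neq (a b : D) : adjacent a b -> a != b.
  by move=> ab; apply/eqP=> eab; rewrite eab adjacentxx in ab.
(* The orientation to forbid is pulled back from [D] along [f]; the absence of digons makes it
   one. *)
have oe : @orientation_of (complete_graph 3) (fun i j => arc (f i) (f j)).
  move=> i j; split; last by apply/nandP/orP; case: (boolP (arc _ _)) => //= /(avoids_digon_asym avd).
  change ((i != j) = adjacent (f i) (f j)).
  move: i j => [[|[|[|//]]] ?] [[|[|[|//]]] ?]; rewrite /f !(tnth_nth x) /=;
    by rewrite ?adjacentxx // ?xy ?yz ?xz // adjacentC ?xy ?yz ?xz.
apply: (avt _ oe); exists f; split=> //.
by apply/tuple_uniqP; rewrite /= !inE negb_or !adj_neq.
Qed.

(** Triangle-freeness makes [x], [v] and [u], [y] nonadjacent, so with nonadjacent ends the walk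
    would be an induced path. *)
Lemma avoids_walk3_adjacent (x y : D) :
  avoids D (Directed digon) -> avoids D (Undirected (complete_graph 3)) ->
  avoids D (Directed (directed_path 3)) -> walk 3 x y -> adjacent x y.
Proof.
move=> avd avt avp [u xu [v uv [w vy wy]]].
move: wy vy => /= -> vy; apply/negPn/negP=> nxy.
have arc_adj (a b : D) : arc a b -> adjacent a b by rewrite /adjacent => ->.
have nxv := avoids_triangle_free avd avt (arc_adj _ _ xu) (arc_adj _ _ uv).
have nuy := avoids_triangle_free avd avt (arc_adj _ _ uv) (arc_adj _ _ vy).
have nadj (a b : D) : ~~ adjacent a b -> (arc a b = false) * (arc b a = false).
  by case/norP=> /negbTE-> /negbTE->.
have asym (a b : D) (ab : arc a b) := negbTE (avoids_digon_asym avd ab).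
have arc_neq (a b : D) : arc a b -> a != b.
  by move=> ab; apply/eqP=> eab; rewrite eab arc_irr in ab.
apply: avp; exists (tnth [tuple x; u; v; y]); split.
  apply/tuple_uniqP; rewrite /= !inE !negb_or.
  rewrite (arc_neq _ _ xu) (arc_neq _ _ uv) (arc_neq _ _ vy) !andbT /=.
  (* Either of [x = v] and [u = y] would create a digon, and [x = y] would make [u] adjacent to
     [y]. *)
  rewrite -andbA; apply/and3P; split; apply/eqP=> e; move: xu uv vy.
  - by rewrite e => vu /asym; rewrite vu.
  - by rewrite e => yu uv vy; move: nuy; rewrite adjacentC arc_adj.
  - by rewrite e => _ yv /asym; rewrite yv.
move=> [[|[|[|[|//]]]] ?] [[|[|[|[|//]]]] ?]; rewrite !(tnth_nth x) /=;
  by rewrite ?arc_irr ?(nadj _ _ nxv, nadj _ _ nuy, nadj _ _ nxy)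
             ?(xu, uv, vy, asym _ _ xu, asym _ _ uv, asym _ _ vy).
Qed.

End ForbiddenPatterns.

Lemma dichromatic_number_le (D : digraph) k :
  dicolorable D k -> dichromatic_number D <= k.
Proof.
by rewrite /dichromatic_number; case: ex_minnP => m _ min_m /asboolP/min_m.
Qed.

Lemma dichromatic_numberP (D : digraph) : dicolorable D (dichromatic_number D).
Proof. by rewrite /dichromatic_number; case: ex_minnP => m /asboolP. Qed.

Definition cycle_rel : rel 'I_4 := fun i j => j == i.+1 %% 4 :> nat.

Lemma cycle_rel_irr : irreflexive cycle_rel.
Proof. by case=> [[|[|[|[|]]]] ?]. Qed.

Definition directed_4cycle : digraph := Digraph cycle_rel_irr.

Lemma directed_4cycle_avoids_digon : avoids directed_4cycle (Directed digon).
Proof.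
case=> f [_ f_arc].
have := f_arc (inord 0) (inord 1); have := f_arc (inord 1) (inord 0).
rewrite /= /neq_rel -!val_eqE /= !inordK //=.
by move: (f _) (f _) => [[|[|[|[|//]]]] ?] [[|[|[|[|//]]]] ?].
Qed.

Lemma directed_4cycle_avoids_triangle :
  avoids directed_4cycle (Undirected (complete_graph 3)).
Proof.
move=> e oe [f [_ f_arc]].
have adj_f (i j : 'I_3) : i != j -> cycle_rel (f i) (f j) || cycle_rel (f j) (f i).
  by move=> ij; have := f_arc i j; have := f_arc j i; move=> /= -> ->; case: (oe i j) => <-.
have := adj_f (inord 0) (inord 1); have := adj_f (inord 1) (inord 2).
have := adj_f (inord 0) (inord 2).
rewrite -!val_eqE /= !inordK //= => /(_ isT) h1 /(_ isT) h2 /(_ isT); move: h1 h2.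
by move: (f _) (f _) (f _) =>
  [[|[|[|[|//]]]] ?] [[|[|[|[|//]]]] ?] [[|[|[|[|//]]]] ?].
Qed.

(** After three arcs of the 4-cycle the fourth leads back to the start, whereas the path has no arc
    from its end to its start. *)
Lemma directed_4cycle_avoids_path3 :
  avoids directed_4cycle (Directed (directed_path 3)).
Proof.
case=> f [_ f_arc].
have := f_arc (inord 0) (inord 1); have := f_arc (inord 1) (inord 2).
have := f_arc (inord 2) (inord 3); have := f_arc (inord 3) (inord 0).
rewrite /= /succ_rel !inordK //= /cycle_rel => f30 /eqP f23 /eqP f12 /eqP f01.
move: f30; rewrite f23 f12 f01.
by case: (f _) => [[|[|[|[|]]]] ?].
Qed.

Lemma directed_4cycle_dichromatic_gt1 : 1 < dichromatic_number directed_4cycle.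
Proof.
rewrite ltnNge; apply/negP=> le1.
case: (dichromatic_numberP directed_4cycle); move: le1.
(* Zero colors fail because there is a vertex; with one color the whole cycle is monochromatic. *)
case: dichromatic_number => [|[|//]] _ f f_col; first by case: (f (inord 0)).
apply: (f_col ord0); exists [:: inord 0; inord 1; inord 2; inord 3]; split=> //.
  by move=> x _; rewrite inE ord1.
by apply/andP; rewrite /= /cycle_rel !inE -!val_eqE /= !inordK.
Qed.

Theorem theorem10 :
  let C := Forb_ind (fun X => [\/ X = Directed digon,
                                  X = Undirected (complete_graph 3)
                                | X = Directed (directed_path 3)]) in
  class_dichromatic_number C 2 /\
  (exists D : digraph, C D /\ dichromatic_number D = 2).
Proof.
move=> C.
have C_le2 D : C D -> dichromatic_number D <= 2.
  move=> CD; apply/dichromatic_number_le; exists (@parity_coloring D).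
  apply: parity_coloringP => x y.
  apply: avoids_walk3_adjacent; apply: CD;
    [exact: Or31 | exact: Or32 | exact: Or33].
have C_cycle : C directed_4cycle.
  move=> _ [] ->; [exact: directed_4cycle_avoids_digon
    | exact: directed_4cycle_avoids_triangle | exact: directed_4cycle_avoids_path3].
have gt1 := directed_4cycle_dichromatic_gt1.
split; last by exists directed_4cycle; split=> //; apply/eqP; rewrite eqn_leq gt1 C_le2.
by split=> // m /(_ _ C_cycle); apply: leq_trans.
Qed.
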